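(* Let $\sigma=2153\text{-}4$ and $\tau=3154\text{-}2$. For every $n\ge 5$ and all $k,\ell\in\{1,\dots,n\}$ with $k\ne\ell$ the following hold. (a) If $k<\ell<n$, then $T_n(\sigma)[k,\ell]=T_{n-1}(\tau)[\ell]$. If $k<\ell=n$, then $T_n(\sigma)[k,\ell]=T_{n-1}(\tau)[1]$. (b) If $k=n$ and $\ell\ne n-1$, then $T_n(\sigma)[n,\ell]=T_{n-1}(\tau)[\ell+1]$. Also, $T_n(\sigma)[n,n-1]=T_{n-1}(\tau)[n-1]$. (c) If $n>k>\ell+1$, then $T_n(\sigma)[k,\ell]=T_n(\tau)[k+1,\ell+1]$. (d) For any $1\le k<n$, $T_n(\sigma)[k]=T_n(\tau)[k+1]$; and $T_n(\sigma)[n]=T_n(\tau)[1]$. (e) $T_n(\sigma)=T_n(\tau)$. Thus $2153\text{-}4\equiv 3154\text{-}2$, i.e. these two patterns are Wilf-equivalent.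
   Context: $S_n$ is the set of permutations of $\{1,\dots,n\}$ in one-line notation. Two sequences of positive integers of the same length are order-isomorphic, $a_1\cdots a_m\sim b_1\cdots b_m$, if for all $p,q$ one has $a_p<a_q$ iff $b_p<b_q$. A permutation $\pi\in S_n$ contains the quasi-consecutive pattern $\rho=\rho_1\rho_2\rho_3\rho_4\text{-}\rho_5$ (with $\rho_1\cdots\rho_5\in S_5$) if there are indices $1\le i_1<\cdots<i_5\le n$ with $i_{p+1}=i_p+1$ for $p=1,2,3$ and $\pi_{i_1}\cdots\pi_{i_5}\sim\rho_1\cdots\rho_5$; otherwise $\pi$ avoids $\rho$. $T_n(\rho)$ is the number of $\pi\in S_n$ avoiding $\rho$; $T_n(\rho)[k]$ is the number of $\pi\in S_n$ avoiding $\rho$ with $\pi_1=k$; $T_n(\rho)[k,\ell]$ is the number of $\pi\in S_n$ avoiding $\rho$ with $\pi_1=k$ and $\pi_2=\ell$. Patterns $\rho,\rho'$ are Wilf-equivalent, $\rho\equiv\rho'$, if $T_n(\rho)=T_n(\rho')$ for every positive integer $n$. *)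

(* Defs.v *)
From mathcomp Require Import all_boot all_fingroup.

Set Implicit Arguments.
Unset Strict Implicit.
Unset Printing Implicit Defensive.

(* 'S_n permutes 'I_n = {0, ..., n-1}, so position i (counted from 0) of the
   one-line notation carries the letter (pi i).+1 in {1, ..., n}. *)
Definition letter n (pi : 'S_n) (i : 'I_n) : nat := (pi i).+1.

Definition one_line n (pi : 'S_n) : seq nat := [seq letter pi i | i <- enum 'I_n].

Definition order_iso m (a b : 'I_m -> nat) : bool :=
  [forall p, forall q, (a p < a q) == (b p < b q)].

(* The condition i_{p+1} = i_p + 1 for p = 1, 2, 3 concerns the 0-based
   p = 0, 1, 2; the last position i_5 is only required to exceed i_4. *)
Definition quasi_consecutive n (i : {ffun 'I_5 -> 'I_n}) : bool :=
  [forall p : 'I_5, forall q : 'I_5, (p < q) ==> (i p < i q)]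
  && [forall p : 'I_5, forall q : 'I_5,
        (p < 3) && (q == p.+1 :> nat) ==> (i q == (i p).+1 :> nat)].

Definition contains (rho : 'S_5) n (pi : 'S_n) : bool :=
  [exists i : {ffun 'I_5 -> 'I_n},
     quasi_consecutive i && order_iso (fun p => letter pi (i p)) (letter rho)].

Definition avoids (rho : 'S_5) n (pi : 'S_n) : bool := ~~ contains rho pi.

Definition T (rho : 'S_5) (n : nat) : nat := #|[set pi : 'S_n | avoids rho pi]|.

Definition T1 (rho : 'S_5) (n k : nat) : nat :=
  #|[set pi : 'S_n | avoids rho pi & nth 0 (one_line pi) 0 == k]|.

Definition T2 (rho : 'S_5) (n k l : nat) : nat :=
  #|[set pi : 'S_n | avoids rho pi &
       (nth 0 (one_line pi) 0 == k) && (nth 0 (one_line pi) 1 == l)]|.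

Definition wilf_equiv (rho rho' : 'S_5) : Prop :=
  forall n, 0 < n -> T rho n = T rho' n.

Definition of_word (w : seq nat) (i : 'I_5) : 'I_5 := inord (nth 0 w i).-1.

Lemma of_wordK (w : seq nat) (i : 'I_5) :
  perm_eq w (iota 1 5) -> (of_word w i).+1 = nth 0 w i.
Proof.
move=> w5; have : nth 0 w i \in iota 1 5.
  by rewrite -(perm_mem w5) mem_nth // (perm_size w5).
rewrite mem_iota /of_word; case: (nth 0 w i) => //= m lt_m.
by rewrite inordK.
Qed.

Lemma of_word_inj (w : seq nat) : perm_eq w (iota 1 5) -> injective (of_word w).
Proof.
move=> w5 i j eq_ij; have sw : size w = 5 by rewrite (perm_size w5).
have /eqP : nth 0 w i = nth 0 w j by rewrite -!of_wordK // eq_ij.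
rewrite nth_uniq ?sw ?(perm_uniq w5) //.
by move/eqP/val_inj.
Qed.

Definition perm_of_word (w : seq nat) (w5 : perm_eq w (iota 1 5)) : 'S_5 :=
  perm (of_word_inj w5).

Lemma one_line_perm_of_word w (w5 : perm_eq w (iota 1 5)) :
  one_line (perm_of_word w5) = w.
Proof.
have sw : size w = 5 by rewrite (perm_size w5).
apply: (@eq_from_nth _ 0) => [|i]; rewrite size_map size_enum_ord // => lti.
rewrite (nth_map (Ordinal lti)) ?size_enum_ord // /letter permE.
by rewrite of_wordK // nth_enum_ord.
Qed.

(* 2153-4 *)
Definition sigma : 'S_5 := @perm_of_word [:: 2; 1; 5; 3; 4] isT.

(* 3154-2 *)
Definition tau : 'S_5 := @perm_of_word [:: 3; 1; 5; 4; 2] isT.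

(* Main.v *)
Require Import Defs.
From mathcomp Require Import all_boot all_fingroup.
From mathcomp Require Import zify.

Set Implicit Arguments.
Unset Strict Implicit.
Unset Printing Implicit Defensive.

(* Both patterns start with a consecutive 2143; if the first four letters
   k l a b of a word have this shape, the fifth letter must fall between b and a
   for sigma, and between l and k for tau. When the word is a permutation and
   n > k > l + 1, some letter strictly between l and k always comes later, so
   for tau every start with k < b < a is forbidden, whereas for sigma it is
   forbidden exactly when b + 1 < a. Deleting the first letter (or the first
   two) and standardizing therefore expresses the counts with prescribed k, l
   as a count for length n - 1 minus a count for length n - 2 of words whose
   first two letters satisfy the corresponding condition. By induction the
   subtracted terms agree: the shift (a, b) -> (a + 1, b + 1) matches the words
   with a < n - 2, and the sigma-words with a = n - 2 are matched with the
   tau-words with a = b + 1. The first-letter counts follow by summing over l,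
   the terms l = k - 1 for sigma and l = 1 for tau exchanging roles. *)

(** * Pattern avoidance for words as lists *)

Definition occurs (rho : 'S_5) (u : seq nat) : bool :=
  order_iso (fun p : 'I_5 => nth 0 u p) (letter rho).

Definition starts_occ (rho : 'S_5) (w : seq nat) : bool :=
  has (fun y => occurs rho (rcons (take 4 w) y)) (drop 4 w).

(** Every suffix is tested for an occurrence at its very front, so putting a letter before a word
    adds just one condition. *)
Fixpoint avoidw (rho : 'S_5) (w : seq nat) : bool :=
  if w is _ :: w' then ~~ starts_occ rho w && avoidw rho w' else true.

(* Letters are 1-based, so [bump k] shifts the letters [>= k] and fixes the
   default letter 0 of [nth]. *)
Fixpoint words (n : nat) : seq (seq nat) :=
  if n is m.+1 then
    [seq k :: [seq bump k x | x <- w] | k <- iota 1 n, w <- words m]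
  else [:: [::]].
Arguments words : simpl never.

Lemma words0 : words 0 = [:: [::]]. Proof. by []. Qed.

Lemma wordsS n :
  words n.+1 =
    [seq k :: [seq bump k x | x <- w] | k <- iota 1 n.+1, w <- words n].
Proof. by []. Qed.

Lemma wordsSP n u :
  u \in words n.+1 ->
  exists k w, [/\ 0 < k <= n.+1, w \in words n &
    u = k :: [seq bump k x | x <- w]].
Proof.
rewrite wordsS => /allpairsP[[k w] [kn wn ->]]; exists k, w.
by rewrite mem_iota in kn.
Qed.

Lemma ltn_bump2 h i j : (bump h i < bump h j) = (i < j).
Proof. by rewrite !ltnNge leq_bump2. Qed.

Lemma nth_map_bump h w i :
  0 < h -> nth 0 [seq bump h x | x <- w] i = bump h (nth 0 w i).
Proof.
move=> h0; have [lt_i|ge_i] := ltnP i (size w); first exact: nth_map.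
by rewrite !nth_default ?size_map //; case: h h0.
Qed.

Lemma occurs_bump rho h u :
  0 < h -> occurs rho [seq bump h x | x <- u] = occurs rho u.
Proof.
move=> h0; apply: eq_forallb => p; apply: eq_forallb => q.
by rewrite !nth_map_bump // ltn_bump2.
Qed.

Lemma starts_occ_bump rho h w :
  0 < h -> starts_occ rho [seq bump h x | x <- w] = starts_occ rho w.
Proof.
move=> h0; rewrite /starts_occ -map_take -map_drop has_map; apply: eq_has => y.
by rewrite -[RHS](occurs_bump _ _ h0) map_rcons.
Qed.

Lemma avoidw_bump rho h w :
  0 < h -> avoidw rho [seq bump h x | x <- w] = avoidw rho w.
Proof.
by move=> h0; elim: w => //= x w ->; rewrite -map_cons starts_occ_bump.
Qed.

Lemma starts_occP rho w :
  reflect (exists2 q, 3 < q < size w &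
      occurs rho [:: nth 0 w 0; nth 0 w 1; nth 0 w 2; nth 0 w 3; nth 0 w q])
    (starts_occ rho w).
Proof.
case: w => [|a [|b [|c [|d t]]]] /=;
  try by constructor=> -[q /andP[q3 lt_q] _]; lia.
rewrite /starts_occ /= take0 drop0 /=; apply: (iffP (has_nthP 0)).
  by move=> [i lt_i oc]; exists i.+4.
by move=> [] [|[|[|[|q]]]] //= lt_q oc; exists q.
Qed.

Lemma avoidwPn rho w :
  reflect (exists p q, [/\ p.+3 < q, q < size w &
      occurs rho [:: nth 0 w p; nth 0 w p.+1; nth 0 w p.+2; nth 0 w p.+3;
                     nth 0 w q]])
    (~~ avoidw rho w).
Proof.
elim: w => [|x w IH]; first by constructor=> -[p [q []]].
rewrite /= negb_and negbK; apply: (iffP orP).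
  case=> [/starts_occP[q /andP[q3 lt_q] oc]|/IH[p [q [pq lt_q oc]]]].
    by exists 0, q.
  by exists p.+1, q.+1.
move=> [[|p] [q [pq lt_q oc]]].
  by left; apply/starts_occP; exists q => //; rewrite pq.
case: q pq lt_q oc => // q pq lt_q oc.
by right; apply/IH; exists p, q.
Qed.

(** * Permutations as words *)

Lemma size_one_line n (pi : 'S_n) : size (one_line pi) = n.
Proof. by rewrite size_map size_enum_ord. Qed.

Lemma nth_one_line n (pi : 'S_n) (i : 'I_n) :
  nth 0 (one_line pi) i = letter pi i.
Proof. by rewrite (nth_map i) ?size_enum_ord // nth_ord_enum. Qed.

Lemma avoids_one_line rho n (pi : 'S_n) :
  avoids rho pi = avoidw rho (one_line pi).
Proof.
apply/negb_inj; rewrite negbK; apply/existsP/avoidwPn.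
  move=> [i /andP[/andP[/forallP inc /forallP cons] oi]].
  have cE (a b : 'I_5) : a < 3 -> b = a.+1 :> nat -> i b = (i a).+1 :> nat.
    move=> a3 ba; move/forallP: (cons a) => /(_ b).
    by rewrite a3 ba eqxx => /eqP.
  pose o0 := @Ordinal 5 0 isT; pose o1 := @Ordinal 5 1 isT.
  pose o2 := @Ordinal 5 2 isT; pose o3 := @Ordinal 5 3 isT.
  pose o4 := @Ordinal 5 4 isT.
  (* The first four positions are consecutive, so [i o0] and [i o4] determine the occurrence. *)
  have e1 : i o1 = (i o0).+1 :> nat by exact: cE.
  have e2 : i o2 = (i o0).+2 :> nat by rewrite (cE o1 o2) // e1.
  have e3 : i o3 = (i o0).+3 :> nat by rewrite (cE o2 o3) // e2.
  exists (i o0), (i o4); split.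
  - by rewrite -e3; move/forallP: (inc o3) => /(_ o4) /implyP; apply.
  - by rewrite size_one_line.
  rewrite -e3 -e2 -e1 !nth_one_line.
  have nE (p : 'I_5) : nth 0 [:: letter pi (i o0); letter pi (i o1);
      letter pi (i o2); letter pi (i o3); letter pi (i o4)] p = letter pi (i p).
    case: p => [[|[|[|[|[|//]]]]] lt_p] /=; congr (letter pi (i _));
      exact: val_inj.
  apply/forallP => p; apply/forallP => q; rewrite !nE.
  by move/forallP: oi => /(_ p) /forallP.
move=> [p [q [pq]]]; rewrite size_one_line => lt_q oc.
case: n pi lt_q oc => // n pi lt_q oc.
pose f := [ffun j : 'I_5 =>
  inord (nth 0 [:: p; p.+1; p.+2; p.+3; q] j) : 'I_n.+1].
have fE (j : 'I_5) : f j = nth 0 [:: p; p.+1; p.+2; p.+3; q] j :> nat.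
  by rewrite ffunE inordK //; case: j => [[|[|[|[|[|//]]]]] lt_j] /=; lia.
exists f; apply/andP; split.
  apply/andP; split; apply/forallP => a; apply/forallP => b; rewrite !fE;
  by case: a b => [[|[|[|[|[|//]]]]] ?] [[|[|[|[|[|//]]]]] ?] /=; lia.
have lE (j : 'I_5) : letter pi (f j) = nth 0 [:: nth 0 (one_line pi) p;
   nth 0 (one_line pi) p.+1; nth 0 (one_line pi) p.+2; nth 0 (one_line pi) p.+3;
   nth 0 (one_line pi) q] j.
  by rewrite -nth_one_line fE; case: j => [[|[|[|[|[|//]]]]] lt_j].
apply/forallP => a; apply/forallP => b; rewrite !lE.
by move/forallP: oc => /(_ a) /forallP.
Qed.

Lemma mem_words n w :
  uniq w -> size w = n -> all (fun x => 0 < x <= n) w -> w \in words n.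
Proof.
elim: n w => [|n IH] [|k w] //= /andP[kw uw] [sw] /andP[k1 aw].
(* As [k] is not a letter of [w], [bump k] undoes [unbump k] on [w]. *)
have bw : w = [seq bump k x | x <- [seq unbump k x | x <- w]].
  rewrite -map_comp -[LHS]map_id; apply/eq_in_map => x xw /=.
  by rewrite unbumpKcond; case: eqP xw kw => // <- ->.
rewrite bw; apply/allpairsP; exists (k, [seq unbump k x | x <- w]).
split=> //=; first by rewrite (mem_iota 1 n.+1) add1n ltnS.
apply: IH; last 1 first.
- rewrite all_map; apply/allP => x xw /=; have := allP aw x xw.
  have xk : x != k by apply: contraNneq kw => <-.
  rewrite /unbump; lia.
- by move: uw; rewrite {1}bw => /map_uniq.
by rewrite size_map.
Qed.

(** This supplies the fifth letter of the forced occurrences of both patterns. *)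
Lemma words_letter n w x : w \in words n -> 0 < x <= n -> x \in w.
Proof.
elim: n w x => [|n IH] w x; first by case: x.
move=> /wordsSP[k [v [kn vn ->]]] xn.
rewrite inE; have [//|xk /=] := eqVneq x k.
apply/mapP; exists (unbump k x); last by rewrite unbumpKcond (negPf xk).
by apply: IH => //; rewrite /unbump; lia.
Qed.

Lemma size_words n : size (words n) = n`!.
Proof.
by elim: n => // n IH; rewrite wordsS size_allpairs size_iota IH factS.
Qed.

(** The one-line notations are pairwise distinct and lie in [words n], and both lists have n!
    entries. *)
Lemma perm_one_line_words n :
  perm_eq [seq one_line pi | pi <- enum 'S_n] (words n).
Proof.
have inj : injective (@one_line n).
  move=> s t st; apply/permP => i; apply/val_inj/succn_inj.
  by rewrite -/(letter s i) -/(letter t i) -!nth_one_line st.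
have u : uniq [seq one_line pi | pi <- enum 'S_n].
  by rewrite map_inj_uniq ?enum_uniq.
have sub : {subset [seq one_line pi | pi <- enum 'S_n] <= words n}.
  move=> _ /mapP[pi _ ->]; apply: mem_words; rewrite ?size_one_line //.
    by rewrite map_inj_uniq ?enum_uniq // => i j [] /val_inj /perm_inj.
  by apply/allP => _ /mapP[i _ ->]; rewrite /letter /= ltn_ord.
have sz : size (words n) <= size [seq one_line pi | pi <- enum 'S_n].
  by rewrite size_words size_map -cardE card_Sn.
apply: uniq_perm => //; first exact: leq_size_uniq sz.
by case: (uniq_min_size u sub sz).
Qed.

Lemma words_nth_le n w i : w \in words n -> nth 0 w i <= n.
Proof.
elim: n w i => [|n IH] w i.
  by rewrite words0 inE => /eqP->; rewrite nth_nil.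
move=> /wordsSP[k [v [kn vn ->]]]; case: i => [|i] /=; first lia.
by rewrite nth_map_bump; [have := IH _ i vn; rewrite /bump; lia | lia].
Qed.

Lemma words_nth_gt0 n w i : w \in words n -> i < n -> 0 < nth 0 w i.
Proof.
elim: n w i => // n IH w i /wordsSP[k [v [kn vn ->]]].
case: i => [|i] /= lt_i; first lia.
by rewrite nth_map_bump; [have := IH _ i vn lt_i; rewrite /bump; lia | lia].
Qed.

(** * Counting avoiding words *)

Lemma count_allpairs (S1 S2 S3 : Type) (f : S1 -> S2 -> S3) s t P :
  count P [seq f x y | x <- s, y <- t] =
    \sum_(x <- s) count (fun y => P (f x y)) t.
Proof.
rewrite count_flatten sumnE big_map big_map.
by apply: eq_bigr => x _; rewrite count_map.
Qed.

Lemma count_fiber (S : eqType) (f : S -> nat) (P : pred S) (r : seq nat) s :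
  uniq r -> {in s, forall x, P x -> f x \in r} ->
  count P s = \sum_(b <- r) count (fun x => P x && (f x == b)) s.
Proof.
move=> ur; elim: s => [|x s IH] fr; first by rewrite big1.
rewrite /= IH => [|y ys]; last by apply: fr; rewrite inE ys orbT.
rewrite big_split /=; congr (_ + _).
have [Px|_] /= := boolP (P x); last by rewrite big1.
rewrite (bigD1_seq (f x)) ?fr ?mem_head //= eqxx big1 // => b.
by rewrite eq_sym => /negPf->.
Qed.

Definition Nw rho n (P : pred (seq nat)) : nat :=
  count (fun w => avoidw rho w && P w) (words n).

(** Counterparts of [T], [T1] and [T2] on lists. *)
Definition N0 rho n := Nw rho n predT.
Definition N1 rho n k := Nw rho n (fun w => nth 0 w 0 == k).
Definition N2 rho n k l :=
  Nw rho n (fun w => (nth 0 w 0 == k) && (nth 0 w 1 == l)).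

Lemma card_avoids rho n (P : pred (seq nat)) :
  #|[set pi : 'S_n | avoids rho pi & P (one_line pi)]| = Nw rho n P.
Proof.
rewrite /Nw -(seq.permP (perm_one_line_words n)) count_map.
rewrite -sum1_card -sum1_count big_enum_cond.
by apply: eq_bigl => pi; rewrite !inE /= avoids_one_line.
Qed.

Lemma eq_Nw rho n P Q : {in words n, P =1 Q} -> Nw rho n P = Nw rho n Q.
Proof. by move=> PQ; apply: eq_in_count => w wn; rewrite PQ. Qed.

Lemma Nw0 rho n (P : pred (seq nat)) :
  {in words n, forall w, ~~ P w} -> Nw rho n P = 0.
Proof.
move=> P0; rewrite (@eq_Nw _ _ _ pred0) => [|w wn]; last exact/negbTE/P0.
by rewrite /Nw (eq_count (a2 := pred0)) ?count_pred0 // => w; rewrite /= andbF.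
Qed.

Lemma Nw_fiber rho n (f : seq nat -> nat) (P : pred (seq nat)) r :
  uniq r -> {in words n, forall w, P w -> f w \in r} ->
  Nw rho n P = \sum_(b <- r) Nw rho n (fun w => P w && (f w == b)).
Proof.
move=> ur fr; rewrite /Nw (count_fiber ur (f := f)).
  by apply: eq_bigr => b _; apply: eq_count => w; rewrite andbA.
by move=> w wn /andP[_]; apply: fr.
Qed.

Lemma Nw_split rho n (P Q : pred (seq nat)) :
  Nw rho n (fun w => ~~ Q w && P w) + Nw rho n (fun w => Q w && P w) =
    Nw rho n P.
Proof.
rewrite /Nw; elim: (words n) => //= w s <-.
by case: (avoidw rho w) (Q w) (P w) => [] [] [] /=; lia.
Qed.

Lemma Nw_head rho n k (P : pred (seq nat)) : 0 < k <= n.+1 ->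
  Nw rho n.+1 (fun w => (nth 0 w 0 == k) && P w) =
    Nw rho n (fun w => ~~ starts_occ rho (k :: [seq bump k x | x <- w])
                       && P (k :: [seq bump k x | x <- w])).
Proof.
move=> kn; rewrite /Nw wordsS count_allpairs.
rewrite (bigD1_seq k) ?iota_uniq ?mem_iota //= big1 => [|j /negPf jk].
  rewrite addn0; apply: eq_count => w /=; rewrite eqxx /= avoidw_bump; last lia.
  by rewrite -andbA andbCA.
rewrite (eq_count (a2 := pred0)) ?count_pred0 // => w.
by rewrite /= jk /= andbF.
Qed.

Lemma N1_cons rho n k : 0 < k <= n.+1 ->
  N1 rho n.+1 k =
    Nw rho n (fun w => ~~ starts_occ rho (k :: [seq bump k x | x <- w])).
Proof.
move=> kn; have := Nw_head rho predT kn; rewrite /N1.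
under eq_Nw do rewrite andbT; move=> ->.
by apply: eq_Nw => w _; rewrite andbT.
Qed.

(** Deleting [k] leaves an avoiding word with first letter [unbump k l]; those in which putting [k]
    back creates an occurrence are added on the left, which avoids truncated subtraction. *)
Lemma N2_cons rho n k l : 0 < k <= n.+1 -> k != l ->
  N2 rho n.+1 k l
  + Nw rho n (fun w => starts_occ rho (k :: [seq bump k x | x <- w])
                       && (nth 0 w 0 == unbump k l)) =
    N1 rho n (unbump k l).
Proof.
move=> kn kl; rewrite /N2 Nw_head // -[RHS](Nw_split _ _ _
  (fun w => starts_occ rho (k :: [seq bump k x | x <- w]))).
congr (_ + _); apply: eq_Nw => w _ /=; congr andb.
rewrite nth_map_bump; last lia.
move: kl; rewrite /bump /unbump; lia.
Qed.

Lemma N2_tail rho n k l : 0 < k <= n.+1 -> k != l ->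
  (forall w, w \in words n -> nth 0 w 0 = unbump k l ->
     ~~ starts_occ rho (k :: [seq bump k x | x <- w])) ->
  N2 rho n.+1 k l = N1 rho n (unbump k l).
Proof.
move=> kn kl no; rewrite -(N2_cons rho kn kl) Nw0 ?addn0 // => w wn.
by apply/negP => /andP[st /eqP hd]; move: (no w wn hd); rewrite st.
Qed.

(** * Occurrences of the two patterns *)

Lemma occurs_sigma a b c d y :
  occurs sigma [:: a; b; c; d; y] = [&& b < a, a < d, d < y & y < c].
Proof.
have lE (p : 'I_5) : letter sigma p = nth 0 [:: 2; 1; 5; 3; 4] p.
  by rewrite -nth_one_line one_line_perm_of_word.
apply/'forall_forallP/idP => [H | H p q].
  have E i j (i5 : i < 5) (j5 : j < 5) := eqP (H (Ordinal i5) (Ordinal j5)).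
  (* The positions of the pattern are run through by increasing letter; this chain decides all other
     comparisons. *)
  move: (E 1 0 isT isT) (E 0 3 isT isT) (E 3 4 isT isT) (E 4 2 isT isT).
  by rewrite !lE /= => -> -> -> ->.
rewrite !lE; case: p q => [[|[|[|[|[|//]]]]] ?] [[|[|[|[|[|//]]]]] ?] /=; lia.
Qed.

Lemma occurs_tau a b c d y :
  occurs tau [:: a; b; c; d; y] = [&& b < y, y < a, a < d & d < c].
Proof.
have lE (p : 'I_5) : letter tau p = nth 0 [:: 3; 1; 5; 4; 2] p.
  by rewrite -nth_one_line one_line_perm_of_word.
apply/'forall_forallP/idP => [H | H p q].
  have E i j (i5 : i < 5) (j5 : j < 5) := eqP (H (Ordinal i5) (Ordinal j5)).
  move: (E 1 4 isT isT) (E 4 0 isT isT) (E 0 3 isT isT) (E 3 2 isT isT).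
  by rewrite !lE /= => -> -> -> ->.
rewrite !lE; case: p q => [[|[|[|[|[|//]]]]] ?] [[|[|[|[|[|//]]]]] ?] /=; lia.
Qed.

Lemma starts_occ_sigma a b c d t :
  starts_occ sigma [:: a, b, c, d & t]
    = [&& b < a, a < d & has (fun y => d < y < c) t].
Proof.
rewrite /starts_occ /= take0 drop0; elim: t => [|y t /= ->].
  by rewrite !andbF.
by rewrite occurs_sigma; case: (b < a) (a < d) => [] [].
Qed.

Lemma starts_occ_tau a b c d t :
  starts_occ tau [:: a, b, c, d & t]
    = [&& a < d, d < c & has (fun y => b < y < a) t].
Proof.
rewrite /starts_occ /= take0 drop0; elim: t => [|y t /= ->].
  by rewrite !andbF.
rewrite occurs_tau.
by case: (b < y) (y < a) (a < d) (d < c) => [] [] [] [].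
Qed.

Lemma starts_occ_short rho w : size w <= 4 -> ~~ starts_occ rho w.
Proof. by move=> w4; rewrite /starts_occ drop_oversize. Qed.

(** The common shape 2143: an initial ascent, a first letter 1 or a maximal first letter already
    violates it. *)
Lemma starts_occ_lt rho w :
  rho = sigma \/ rho = tau -> starts_occ rho w ->
  [/\ nth 0 w 1 < nth 0 w 0, nth 0 w 0 < nth 0 w 3 & nth 0 w 3 < nth 0 w 2].
Proof.
move=> st /starts_occP[q _]; case: st => ->;
  by rewrite ?occurs_sigma ?occurs_tau => /and4P[*]; split; lia.
Qed.

(** * Counts with prescribed first letters *)

Lemma N2_asc rho n k l (rho_st : rho = sigma \/ rho = tau) :
  0 < k < l -> l <= n.+1 -> N2 rho n.+1 k l = N1 rho n l.-1.
Proof.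
move=> kl ln.
have ub : unbump k l = l.-1 by rewrite /unbump; lia.
rewrite -ub; apply: N2_tail => [||w wn hd]; try lia.
apply/negP => /(starts_occ_lt rho_st)[/=].
rewrite !nth_map_bump ?hd ?ub ?/bump; lia.
Qed.

Lemma N2_top rho n l (rho_st : rho = sigma \/ rho = tau) :
  0 < l <= n -> N2 rho n.+1 n.+1 l = N1 rho n l.
Proof.
move=> ln.
have ub : unbump n.+1 l = l by rewrite /unbump; lia.
rewrite -[in RHS]ub; apply: N2_tail => [||w wn hd]; try lia.
apply/negP => /(starts_occ_lt rho_st)[/= _].
rewrite !nth_map_bump //.
have := words_nth_le 2 wn; rewrite /bump; lia.
Qed.

Lemma N1_one rho n (rho_st : rho = sigma \/ rho = tau) :
  N1 rho n.+1 1 = N0 rho n.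
Proof.
rewrite N1_cons //; apply: eq_Nw => w wn; apply/negP.
move=> /(starts_occ_lt rho_st)[/=].
rewrite !nth_map_bump //.
(* A positive [nth 0 w 2] forces [0 < n], so the first letter of [w] is not the default 0. *)
have := words_nth_le 2 wn; have := @words_nth_gt0 n w 0 wn.
rewrite /bump; lia.
Qed.

Lemma N1_top rho n (rho_st : rho = sigma \/ rho = tau) :
  N1 rho n.+1 n.+1 = N0 rho n.
Proof.
rewrite N1_cons ?ltnS ?leqnn //; apply: eq_Nw => w wn; apply/negP.
move=> /(starts_occ_lt rho_st)[/= _].
rewrite !nth_map_bump //.
have := words_nth_le 2 wn; rewrite /bump; lia.
Qed.

(** No later letter fits strictly between [l] and [l.+1], as [tau] would require. *)
Lemma N2_tau_adj n l : 0 < l <= n -> N2 tau n.+1 l.+1 l = N1 tau n l.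
Proof.
move=> ln.
have ub : unbump l.+1 l = l by rewrite /unbump; lia.
rewrite -[in RHS]ub; apply: N2_tail => [||w wn hd]; try lia.
apply/negP => /starts_occP[q _] /=.
rewrite !nth_map_bump // hd ub occurs_tau => /and4P[].
rewrite /bump; lia.
Qed.

(* What remains, once the first two letters k, l are deleted, of the words that
   start with a forbidden k l a b: j = k - 1, with c = 1 for sigma and c = 0 for
   tau. *)
Definition Nd rho c n j :=
  Nw rho n (fun w => (j <= nth 0 w 1) && (nth 0 w 1 + c < nth 0 w 0)).

Lemma N2_sigma_split n k l : 0 < l < k -> k <= n.+2 ->
  N2 sigma n.+2 k l + Nd sigma 1 n k.-1 = N1 sigma n.+1 l.
Proof.
move=> lk kn.
have ub : unbump k l = l by rewrite /unbump; lia.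
rewrite -[in RHS]ub -(@N2_cons _ _ k); [|lia|lia].
congr (_ + _); rewrite ub; under [RHS]eq_Nw do rewrite andbC.
rewrite Nw_head; last lia.
apply: eq_Nw => v vn; apply/idP/andP; last first.
  case=> _; case: v vn => [|a [|b t]] vn;
    try by rewrite (negPf (starts_occ_short _ _)).
  rewrite /= starts_occ_sigma => /and3P[_ kb /hasP[y _]].
  by move: kb; rewrite /bump; lia.
(* In a word with fewer than two letters the default 0 at index 1 is below [k.-1]. *)
case: v vn => [|a [|b t]] vn /=; try lia.
move=> ab; split.
  (* No occurrence starts at [l], since the next letter is larger. *)
  by apply/negP => /(starts_occ_lt (or_introl erefl))[/=];
    rewrite /bump; lia.
rewrite starts_occ_sigma; apply/and3P; split; try (rewrite /bump; lia).
(* As [b + 1 < a], the letter [b.+1] comes after both and lies strictly between them. *)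
have : b.+1 \in [:: a, b & t].
  by apply: (words_letter vn); have := words_nth_le 0 vn; rewrite /=; lia.
rewrite !inE => /or3P[|| bt]; try lia.
rewrite !has_map; apply/hasP; exists b.+1 => //=; rewrite /bump; lia.
Qed.

Lemma N2_tau_split n k l : 0 < l -> l.+1 < k -> k <= n.+2 ->
  N2 tau n.+2 k l + Nd tau 0 n k.-1 = N1 tau n.+1 l.
Proof.
move=> l0 lk kn.
have ub : unbump k l = l by rewrite /unbump; lia.
rewrite -[in RHS]ub -(@N2_cons _ _ k); [|lia|lia].
congr (_ + _); rewrite ub; under [RHS]eq_Nw do rewrite andbC.
rewrite Nw_head; last lia.
apply: eq_Nw => v vn; apply/idP/andP; last first.
  case=> _; case: v vn => [|a [|b t]] vn;
    try by rewrite (negPf (starts_occ_short _ _)).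
  rewrite /= starts_occ_tau => /and3P[kb ba _].
  by move: kb ba; rewrite /bump; lia.
case: v vn => [|a [|b t]] vn /=; try lia.
move=> ab; split.
  by apply/negP => /(starts_occ_lt (or_intror erefl))[/=];
    rewrite /bump; lia.
rewrite starts_occ_tau; apply/and3P; split; try (rewrite /bump; lia).
(* Reinserting [l] and [k] turns the letter [l] of [v] into [l.+1], strictly between [l] and [k]; as
   [l < b < a], it comes after [a] and [b]. *)
have : l \in [:: a, b & t] by apply: (words_letter vn); lia.
rewrite !inE => /or3P[|| lt]; try lia.
rewrite !has_map; apply/hasP; exists l => //=; rewrite /bump; lia.
Qed.

(** * Summation over first letters and induction on the length *)

Lemma Nd_sum rho c n j : 0 < j ->
  Nd rho c n j = \sum_(j <= b < n) \sum_((b + c).+1 <= a < n.+1) N2 rho n a b.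
Proof.
move=> j0; rewrite /Nd (@Nw_fiber _ _ (fun w => nth 0 w 1) _ (index_iota j n)).
- apply: eq_big_nat => b jb.
  rewrite (@Nw_fiber _ _ (fun w => nth 0 w 0) _ (index_iota (b + c).+1 n.+1)).
  + apply: eq_big_nat => a ba; apply: eq_Nw => w _ /=; lia.
  + exact: iota_uniq.
  by move=> w wn /=; rewrite mem_index_iota; have := words_nth_le 0 wn; lia.
- exact: iota_uniq.
by move=> w wn /=; rewrite mem_index_iota; have := words_nth_le 0 wn; lia.
Qed.

Lemma N1_sum rho n k : 1 < n -> N1 rho n k = \sum_(1 <= l < n.+1) N2 rho n k l.
Proof.
move=> n1; apply: Nw_fiber => [|w wn _]; first exact: iota_uniq.
rewrite mem_index_iota; have := words_nth_le 1 wn.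
by have := words_nth_gt0 wn n1; lia.
Qed.

Lemma N0_sum rho n : 0 < n -> N0 rho n = \sum_(1 <= k < n.+1) N1 rho n k.
Proof.
move=> n0; apply: (@Nw_fiber _ _ (fun w => nth 0 w 0)) => [|w wn _].
  exact: iota_uniq.
rewrite mem_index_iota; have := words_nth_le 0 wn.
by have := words_nth_gt0 wn n0; lia.
Qed.

Lemma N2_diag rho n k : 0 < n -> N2 rho n k k = 0.
Proof.
case: n => // n _; apply: Nw0 => _ /wordsSP[h [v [hn vn ->]]] /=.
rewrite nth_map_bump; [rewrite /bump; lia | lia].
Qed.

(** The statement for the induction: (c), (d) and (e) at every length. The guard in [eq_N1_top] is
    there because the empty word has default first letter 0, so [N1 sigma 0 0] is 1. *)
Record equidistributed n : Prop := Equidistributed {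
  eq_N2 : forall k l, 0 < l -> l.+1 < k < n ->
    N2 sigma n k l = N2 tau n k.+1 l.+1;
  eq_N1 : forall k, 0 < k < n -> N1 sigma n k = N1 tau n k.+1;
  eq_N1_top : 0 < n -> N1 sigma n n = N1 tau n 1;
  eq_N0 : N0 sigma n = N0 tau n
}.

Lemma Nd_shift m j : equidistributed m -> equidistributed m.-1 -> 0 < j ->
  Nd sigma 1 m j = Nd tau 0 m j.+1.
Proof.
case: m => [|p] /= Em Ep j0; first by rewrite !Nd_sum // !big_geq.
have [pj|jp] := ltnP p j.
  by rewrite !Nd_sum // !big_geq // ltnW.
(* For [sigma] the term [b = p] is an empty sum, since [a] would have to exceed [p.+1]. *)
rewrite !Nd_sum // big_nat_recr //= [X in _ + X]big_geq ?addn1 // addn0.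
rewrite [RHS]big_add1 /=; apply: eq_big_nat => b jb.
rewrite addn0 [RHS]big_add1 /= addn1.
rewrite big_nat_recr /=; last lia.
rewrite [LHS]addnC [RHS]big_ltn; last lia.
(* The two unmatched terms, [a = p.+1] for [sigma] and adjacent letters for [tau], reduce to
   first-letter counts at length [p]. *)
rewrite N2_top; [|by left|lia].
rewrite (eq_N1 Ep) ?N2_tau_adj; [|lia|lia].
congr (_ + _); apply: eq_big_nat => a ba.
by apply: (eq_N2 Em); lia.
Qed.

Lemma equidistributed_all n : equidistributed n.
Proof.
have [m] := ubnP n; elim: m n => // m IH [_|n nm]; first by split=> //; lia.
have En : equidistributed n by apply: IH; lia.
have En1 : equidistributed n.-1 by apply: IH; lia.
have En2 : equidistributed n.-2 by apply: IH; lia.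
have E2 k l : 0 < l -> l.+1 < k < n.+1 ->
    N2 sigma n.+1 k l = N2 tau n.+1 k.+1 l.+1.
  move=> l0 lk; case: n {IH nm} En En1 En2 lk => [|p] /= En En1 En2 lk.
    lia.
  have := @N2_sigma_split p k l; have := @N2_tau_split p k.+1 l.+1.
  have := @Nd_shift p k.-1 En1 En2.
  have := @eq_N1 _ En l.
  rewrite !prednK /=; lia.
have Etop : N1 sigma n.+1 n.+1 = N1 tau n.+1 1.
  by rewrite N1_top ?N1_one ?(eq_N0 En) //; [right | left].
have E1 k : 0 < k < n.+1 -> N1 sigma n.+1 k = N1 tau n.+1 k.+1.
  case: n {IH nm Etop} En En1 En2 E2 => [|p] /= En En1 En2 E2 kn; first lia.
  (* Ascents agree up to the surplus [N1 tau p.+1 1], which comes from [l = p.+2]. *)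
  have asc_sigma : \sum_(k.+1 <= l < p.+3) N2 sigma p.+2 k l =
      \sum_(k <= l < p.+1) N1 tau p.+1 l.+1 + N1 tau p.+1 1.
    rewrite big_add1 /= big_nat_recr //=; last lia.
    rewrite N2_asc; [|by left|lia|lia].
    rewrite /= (eq_N1_top En) //; congr (_ + _); apply: eq_big_nat => l kl.
    rewrite N2_asc; [|by left|lia|lia].
    by apply: (eq_N1 En); lia.
  have asc_tau : \sum_(k.+2 <= l < p.+3) N2 tau p.+2 k.+1 l =
      \sum_(k <= l < p.+1) N1 tau p.+1 l.+1.
    rewrite !big_add1 /=; apply: eq_big_nat => l kl.
    by rewrite N2_asc; [|by right|lia|lia].
  rewrite !N1_sum // (big_cat_nat (n := k)) //=; [|lia|lia].
  rewrite [X in _ + X]big_ltn; last lia.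
  rewrite N2_diag // add0n asc_sigma.
  rewrite [RHS](big_cat_nat (n := k.+1)) //=; last lia.
  rewrite [X in _ = _ + X]big_ltn; last lia.
  rewrite N2_diag // add0n asc_tau [X in _ = X + _]big_nat_recr /=; last lia.
  rewrite N2_tau_adj; last lia.
  (* For [k = 1] the adjacent term of [tau] is exactly that surplus. *)
  have [k1|k1] := leqP k 1.
    have -> : k = 1 by lia.
    by rewrite !(@big_geq _ _ _ 1 1) // !add0n addnC.
  case: k k1 kn {asc_sigma asc_tau} => // k k1 kn.
  rewrite big_nat_recr /=; last lia.
  rewrite [X in _ = X + _ + _]big_ltn; last lia.
  rewrite [X in _ = _ + X + _ + _]big_add1 /=.
  have -> : \sum_(1 <= l < k) N2 sigma p.+2 k.+1 l =
      \sum_(1 <= l < k) N2 tau p.+2 k.+2 l.+1.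
    by apply: eq_big_nat => l lk; apply: E2; lia.
  (* Left over are [l = k] and the surplus for [sigma], against [l = 1] and the adjacent term for
     [tau]; the splits turn these into equal first-letter counts minus equal [Nd] terms. *)
  have := @N2_sigma_split p k.+1 k; have := @N2_tau_split p k.+2 1.
  have := @Nd_shift p k En1 En2; have := @eq_N1 _ En k.
  rewrite /=; lia.
split=> //.
rewrite !N0_sum // big_nat_recr //= [RHS]big_ltn // [in RHS]big_add1 /=.
by rewrite Etop addnC; congr (_ + _); apply: eq_big_nat => k; apply: E1.
Qed.

Theorem theorem5p4 :
  (forall n : nat, 5 <= n ->
     (forall k l : nat, 1 <= k <= n -> 1 <= l <= n -> k <> l ->
        (* (a) *)
        (k < l < n -> T2 sigma n k l = T1 tau (n - 1) l)
        /\ (k < l -> l = n -> T2 sigma n k l = T1 tau (n - 1) 1)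
        (* (b) *)
        /\ (k = n -> l <> n - 1 -> T2 sigma n n l = T1 tau (n - 1) (l + 1))
        /\ (k = n -> l = n - 1 ->
              T2 sigma n n (n - 1) = T1 tau (n - 1) (n - 1))
        (* (c) *)
        /\ (l + 1 < k < n -> T2 sigma n k l = T2 tau n (k + 1) (l + 1)))
     (* (d) *)
     /\ (forall k : nat, 1 <= k < n -> T1 sigma n k = T1 tau n (k + 1))
     /\ T1 sigma n n = T1 tau n 1
     (* (e) *)
     /\ T sigma n = T tau n)
  /\ wilf_equiv sigma tau.
Proof.
have T2E rho n k l : T2 rho n k l = N2 rho n k l.
  exact: (card_avoids rho n (fun w => (nth 0 w 0 == k) && (nth 0 w 1 == l))).
have T1E rho n k : T1 rho n k = N1 rho n k.
  exact: (card_avoids rho n (fun w => nth 0 w 0 == k)).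
have TE rho n : T rho n = N0 rho n.
  rewrite /N0 -card_avoids; apply: eq_card => pi.
  by rewrite !inE andbT.
split=> [n n5|n _]; last by rewrite !TE; apply: eq_N0 (equidistributed_all n).
case: n n5 => // n n5; rewrite subn1 /=.
have En := equidistributed_all n; have ES := equidistributed_all n.+1.
have sig : sigma = sigma \/ sigma = tau by left.
have tu : tau = sigma \/ tau = tau by right.
split=> [k l kn ln kl|]; rewrite ?TE ?T1E ?T2E; last first.
  split=> [k kn|]; first by rewrite !T1E addn1; apply: (eq_N1 ES).
  by rewrite (eq_N1_top ES) // (eq_N0 ES).
rewrite !addn1; split=> [lk|].
  by rewrite N2_asc ?(eq_N1 En) ?prednK //; lia.
split=> [lk ->|].
  rewrite N2_asc //=; [|lia].
  by apply: (eq_N1_top En); lia.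
split=> [kE ln1|].
  by rewrite N2_top // ?(eq_N1 En) //; lia.
split=> [_ _|lk].
  case: n n5 {kn ln} En ES => // n n5 En ES.
  (* For [tau], first letter 1 and maximal first letter are equally frequent: deleting either leaves
     an arbitrary avoiding word. *)
  by rewrite N2_top ?leqnn // (eq_N1_top En) // N1_one ?N1_top.
by apply: (eq_N2 ES); lia.
Qed.
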